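(* Let $(\mathbf X,\mathbf C,\mathbf W)$ be a weighted Max-SAT instance in CNF, let $y$ be a real parameter, and let $p(\mathbf\Lambda)$ be the joint distribution of the extended factor graph of the instance, i.e. the normalized product of all the single variable compatibilities $\Psi_i$ and all the clause compatibilities $\Psi_\beta$ (defined in the context). Then $p$ is positive only over $v$-covers: if $p(\mathbf\Lambda)>0$ then $\mathbf\Lambda=\lambda(\mathbf x)$ for some $\mathbf x\in\{-1,+1,*\}^N$ that is a $v$-cover for some $v$. Moreover, for every $v$-cover $\mathbf x$ (for any $v$), $$p(\mathbf X=\mathbf x)=p(\mathbf\Lambda=\lambda(\mathbf x))\;\propto\;\prod_{\beta\in \mathrm{UNSAT}(\mathbf x)}\exp(-w_\beta y),$$ with a proportionality constant that does not depend on $\mathbf x$, where $\mathrm{UNSAT}(\mathbf x)$ is the set of all clauses violated by $\mathbf x$.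
   Context: Instance. There are $N$ variables $X_i$, $i\in V$, a finite set $\mathbf C$ of clauses (disjunctions of literals, each variable occurring at most once in a clause), and a real weight $w_\beta$ for each $\beta\in\mathbf C$. $V(\beta)\subseteq V$ is the set of variables of clause $\beta$, and $V(i)$ is the set of clauses containing variable $i$. For $i\in V(\beta)$, $s_{\beta,i}=+1$ and $u_{\beta,i}=-1$ if $X_i$ occurs as a positive literal in $\beta$, and $s_{\beta,i}=-1$, $u_{\beta,i}=+1$ if it occurs negated. $V^{\pm}(i)=\{\beta\in V(i): s_{\beta,i}=\pm1\}$. Configurations. Variables take values in $\{-1,+1,*\}$. A configuration $\mathbf x\in\{-1,+1,*\}^N$ satisfies $\beta$ iff some $i\in V(\beta)$ has $x_i=s_{\beta,i}$ or at least two variables of $\beta$ take the value $*$; it violates $\beta$ if $x_j=u_{\beta,j}$ for all $j\in V(\beta)$; it is invalid for $\beta$ iff exactly one variable of $\beta$ equals $*$ and all the other variables $j$ of $\beta$ equal $u_{\beta,j}$. It is valid if it is not invalid for any clause. Variable $X_i$ is constrained by $\beta$ (with $i\in V(\beta)$) if $x_i=s_{\beta,i}$ and $x_j=u_{\beta,j}$ for all $j\in V(\beta)\setminus\{i\}$; $\mathrm{CON}_{i,\beta}(\mathbf x_{V(\beta)})\in\{0,1\}$ is the indicator of this. A variable is unconstrained if it is constrained by no clause. A $v$-cover is a valid configuration $\mathbf x$ such that the total weight of the clauses violated by $\mathbf x$ is $v$ and no unconstrained variable is assigned $-1$ or $+1$. The parent set is $P_i(\mathbf x)=\{\beta\in\mathbf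 C:\mathrm{CON}_{i,\beta}(\mathbf x_{V(\beta)})=1\}$. Extended factor graph. $P(i)$ is the set of all subsets of $V^+(i)$ together with all subsets of $V^-(i)$. The variables are $\mathbf\Lambda=(\Lambda_i)_{i\in V}$ with $\Lambda_i=(x_i,P_i)\in\{-1,+1,*\}\times P(i)$, and $\lambda(\mathbf x)=\big((x_i,P_i(\mathbf x))\big)_{i\in V}$. The factors are as follows. - Single variable compatibilities: $\Psi_i(x_i,P_i)=0$ if $P_i=\emptyset$ and $x_i\neq *$; $\Psi_i=1$ if $P_i=\emptyset$ and $x_i=*$; $\Psi_i=1$ if $P_i\ne\emptyset$ and either ($x_i=+1$, $P_i\subseteq V^+(i)$) or ($x_i=-1$, $P_i\subseteq V^-(i)$); $\Psi_i=0$ for all other pairs. - Clause compatibilities: $\Psi_\beta(\mathbf\Lambda_{V(\beta)})=\mathrm{VAL}_\beta(\mathbf x_{V(\beta)})\prod_{k\in V(\beta)}\mathrm{Ind}\big([\beta\in P_k]=\mathrm{CON}_{k,\beta}(\mathbf x_{V(\beta)})\big)$, where $\mathrm{VAL}_\beta$ is $1$ if $\mathbf x_{V(\beta)}$ satisfies $\beta$, $\exp(-w_\beta y)$ if it violates $\beta$, and $0$ if it is invalid for $\beta$; $\mathrm{Ind}$ is the indicator of its argument. The joint distribution is $p(\mathbf\Lambda)=\frac1Z\prod_{i\in V}\Psi_i(\Lambda_i)\prod_{\beta\in\mathbf C}\Psi_\beta(\mathbf\Lambda_{V(\beta)})$. Since $\mathbf x$ determines $(P_i(\mathbf x))_i$,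 it is identified with a distribution over $\mathbf x$ via $p(\mathbf X=\mathbf x)=p(\mathbf\Lambda=\lambda(\mathbf x))$. *)

(* Defs.v *)
From mathcomp Require Import all_boot all_order all_algebra.
From mathcomp Require Import reals sequences exp.
Set Implicit Arguments.
Unset Strict Implicit.
Unset Printing Implicit Defensive.
Import Order.TTheory GRing.Theory Num.Theory.
Local Open Scope ring_scope.

(* [Some true] is +1, [Some false] is -1 and [None] is the value "*". *)
Definition value : Type := option bool.

Definition star : value := None.
Definition plus : value := Some true.
Definition minus : value := Some false.

(* A clause maps each variable to its literal: [Some true] for a positive
   occurrence, [Some false] for a negated one and [None] for no occurrence, so
   that a variable occurs at most once. *)
Definition clause (N : nat) : Type := {ffun 'I_N -> option bool}.

Definition config (N : nat) : Type := {ffun 'I_N -> value}.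

Section Clause.
Variable N : nat.
Implicit Types (b : clause N) (i j : 'I_N) (x : config N).

Definition vars b : {set 'I_N} := [set i | b i != None].

(* s_{b,i} and u_{b,i} are only meaningful for i in [vars b]
   and are always used under that guard. *)
Definition sval_of b i : value := b i.
Definition uval_of b i : value := omap negb (b i).

Definition satisfies x b : bool :=
  [exists i in vars b, x i == sval_of b i]
  || (2 <= #|[set i in vars b | x i == star]|)%N.

Definition violates x b : bool := [forall j in vars b, x j == uval_of b j].

(* Since [uval_of b j] is not [star] for j in [vars b], the variable i below is
   the only one of b with value [star]. *)
Definition invalid_for x b : bool :=
  [exists i in vars b,
    (x i == star) && [forall j in vars b :\ i, x j == uval_of b j]].

Definition CON i b x : bool :=
  [&& i \in vars b, x i == sval_of b i
    & [forall j in vars b :\ i, x j == uval_of b j]].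

End Clause.

Section Cover.
Variables (R : realType) (N : nat) (C : {set clause N}).
Implicit Types (w : clause N -> R) (v : R) (x : config N) (i : 'I_N).

Definition valid x : bool := [forall b in C, ~~ invalid_for x b].

Definition unconstrained x i : bool := [forall b in C, ~~ CON i b x].

Definition UNSAT x : {set clause N} := [set b in C | violates x b].

Definition v_cover w v x : Prop :=
  [/\ valid x,
      \sum_(b in UNSAT x) w b = v
    & forall i, unconstrained x i -> x i != minus /\ x i != plus].

Definition parents x i : {set clause N} := [set b in C | CON i b x].

End Cover.

Section ExtendedFactorGraph.
Variables (R : realType) (N : nat) (C : {set clause N}).
Variables (w : clause N -> R) (y : R).

Definition Vplus (i : 'I_N) : {set clause N} :=
  [set b in C | (i \in vars b) && (sval_of b i == plus)].
Definition Vminus (i : 'I_N) : {set clause N} :=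
  [set b in C | (i \in vars b) && (sval_of b i == minus)].

Definition parent_space (i : 'I_N) : {set {set clause N}} :=
  powerset (Vplus i) :|: powerset (Vminus i).

Definition in_ext_space (L : {ffun 'I_N -> value * {set clause N}}) : bool :=
  [forall i, (L i).2 \in parent_space i].

Definition ext_config : Type :=
  {L : {ffun 'I_N -> value * {set clause N}} | in_ext_space L}.

Definition ext_val (L : ext_config) (i : 'I_N) : value := (val L i).1.
Definition ext_par (L : ext_config) (i : 'I_N) : {set clause N} := (val L i).2.
Definition ext_x (L : ext_config) : config N := [ffun i => ext_val L i].

Fact lambda_subproof (x : config N) :
  in_ext_space [ffun i => (x i, parents C x i)].
Proof.
apply/forallP => i; rewrite ffunE inE !powersetE /=.
case Ex: (x i) => [[]|]; apply/orP; [left|right|left]; apply/subsetP => b;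
  rewrite !in_set => /andP[-> /and3P[]]; rewrite in_set => iV /eqP.
- by rewrite Ex => <- _; rewrite iV.
- by rewrite Ex => <- _; rewrite iV.
- by rewrite Ex /sval_of => Es; rewrite -Es in iV.
Qed.

Definition lambda (x : config N) : ext_config := Sub _ (lambda_subproof x).

Definition Psi_var (i : 'I_N) (xi : value) (Pi : {set clause N}) : R :=
  if Pi == set0 then (xi == star)%:R
  else ((xi == plus) && (Pi \subset Vplus i)
        || (xi == minus) && (Pi \subset Vminus i))%:R.

(* Exactly one of "satisfies", "violates" and "invalid" holds. *)
Definition VAL (b : clause N) (x : config N) : R :=
  if satisfies x b then 1
  else if violates x b then expR (- (w b * y))
  else 0.

Definition Psi_clause (b : clause N) (L : ext_config) : R :=
  VAL b (ext_x L)
  * \prod_(k in vars b) ((b \in ext_par L k) == CON k b (ext_x L))%:R.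

Definition joint_weight (L : ext_config) : R :=
  (\prod_(i : 'I_N) Psi_var i (ext_val L i) (ext_par L i))
  * \prod_(b in C) Psi_clause b L.

Definition partition_function : R := \sum_(L : ext_config) joint_weight L.

Definition joint (L : ext_config) : R := joint_weight L / partition_function.

Definition config_distr (x : config N) : R := joint (lambda x).

End ExtendedFactorGraph.

(* Main.v *)
(** If [L] has positive weight, no factor vanishes at [L]: the clause factors
    force every [P_i] to be the parent set of [x_i] and exclude invalid
    configurations, and the variable factors then force unconstrained variables
    to be [*].  Conversely, at [lambda x] for a cover [x] every variable factor
    is 1 and a clause factor is [exp (- w y)] or 1 according to whether [x]
    violates the clause. *)
Require Import Defs.
From mathcomp Require Import all_boot all_order all_algebra.
From mathcomp Require Import reals sequences exp.
Import Order.TTheory GRing.Theory Num.Theory.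
Local Open Scope ring_scope.

(** * Satisfied, violated and invalid clauses *)

Section ClauseTrichotomy.
Context {N : nat}.
Implicit Types (b : clause N) (i j : 'I_N) (x : config N).

Lemma vars_uvalNstar b i : i \in vars b -> uval_of b i != star.
Proof. by rewrite inE /uval_of; case: (b i). Qed.

Lemma vars_svalNstar b i : i \in vars b -> sval_of b i != star.
Proof. by rewrite inE. Qed.

Lemma vars_svalNuval b i : i \in vars b -> sval_of b i != uval_of b i.
Proof. by rewrite inE /sval_of /uval_of; case: (b i) => [[]|]. Qed.

(** Other than [star], a variable of [b] can only carry [sval_of] or [uval_of], and the former would
    satisfy [b]. *)
Lemma unsat_value x b i :
  ~~ satisfies x b -> i \in vars b -> x i != star -> x i = uval_of b i.
Proof.
rewrite negb_or => /andP[/existsPn /(_ i) + _] ib; rewrite ib /=.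
move: ib; rewrite inE /sval_of /uval_of.
by case: (b i) => [[]|] //; case: (x i) => [[]|].
Qed.

Lemma violates_unsat x b : violates x b -> ~~ satisfies x b.
Proof.
move=> /forall_inP viol; rewrite negb_or; apply/andP; split.
  apply/existsPn => i; apply/negP => /andP[ib /eqP xi].
  by move: (vars_svalNuval b i ib); rewrite -xi viol.
rewrite -ltnNge ltnS; apply: (@leq_trans 0) => //.
rewrite leqn0 cards_eq0; apply/eqP/setP => i; rewrite in_set in_set0.
apply/negP => /andP[ib /eqP xi].
by move: (vars_uvalNstar b i ib); rewrite -(eqP (viol i ib)) xi.
Qed.

Lemma invalid_unsat x b : invalid_for x b -> ~~ satisfies x b.
Proof.
case/exists_inP => i ib /andP[/eqP xi /forall_inP xu].
have xju j : j \in vars b -> j != i -> x j = uval_of b j.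
  by move=> jb ji; apply/eqP/xu; rewrite in_setD1 ji.
rewrite negb_or; apply/andP; split.
  apply/existsPn => j; apply/negP => /andP[jb /eqP xj].
  have [ji|ji] := eqVneq j i.
    by move: (vars_svalNstar b j jb); rewrite -xj ji xi.
  by move: (vars_svalNuval b j jb); rewrite -xj xju // eqxx.
(* All stars of [b] lie in the singleton of [i], so there are fewer than two. *)
rewrite -ltnNge ltnS -(cards1 i); apply/subset_leq_card/subsetP => j.
rewrite in_set in_set1 => /andP[jb /eqP xj].
apply/negPn/negP => ji.
by move: (vars_uvalNstar b j jb); rewrite -xju // xj.
Qed.

Lemma invalid_not_violates x b : invalid_for x b -> ~~ violates x b.
Proof.
case/exists_inP => i ib /andP[/eqP xi _]; apply/negP => /forall_inP /(_ i ib).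
by rewrite xi eq_sym; apply/negP/vars_uvalNstar.
Qed.

(** This is what identifies the final branch of [VAL], with value 0, as the invalid case. *)
Lemma clause_trichotomy x b :
  [|| satisfies x b, violates x b | invalid_for x b].
Proof.
case sat: (satisfies x b) => //=.
have unsat := negbT sat.
case viol: (violates x b) => //=.
have [i ib xi] : exists2 i, i \in vars b & x i == star.
  move/negbT: viol => /forall_inPn[i ib xi]; exists i => //.
  by apply: contraNT xi => xi; rewrite (unsat_value x b i).
apply/exists_inP; exists i => //; rewrite xi; apply/forall_inP => j.
rewrite in_setD1 => /andP[ji jb]; apply/eqP/unsat_value => //.
apply/negP => xj.
(* A second star [j] next to [i] would satisfy [b], against the assumption. *)
have : satisfies x b.
  apply/orP; right.
  have <- : #|[set i; j]| = 2%N by rewrite cards2 eq_sym ji.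
  apply/subset_leq_card/subsetP => k.
  by rewrite in_set2 in_set => /orP[]/eqP ->; rewrite ?ib ?jb.
by rewrite sat.
Qed.

End ClauseTrichotomy.

(** * Signs and zeros of the factors *)

Section FactorGraph.
Context {R : realType} {N : nat} (C : {set clause N}) (w : clause N -> R) (y : R).
Implicit Types (b : clause N) (i : 'I_N) (x : config N) (L : ext_config C).

Lemma VAL_ge0 b x : 0 <= VAL w y b x.
Proof. by rewrite /VAL; do 2!case: ifP => // _; exact: expR_ge0. Qed.

Lemma VAL_neq0 b x : (VAL w y b x != 0) = ~~ invalid_for x b.
Proof.
rewrite /VAL; case: ifP => [sat|unsat].
  rewrite oner_eq0; apply/esym/negP => /invalid_unsat.
  by rewrite sat.
case: ifP => [viol|nviol].
  rewrite gt_eqF ?expR_gt0 //; apply/esym/negP => /invalid_not_violates.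
  by rewrite viol.
by move: (clause_trichotomy x b); rewrite unsat nviol /= => ->; rewrite eqxx.
Qed.

Lemma VAL_valid b x : ~~ invalid_for x b ->
  VAL w y b x = if violates x b then expR (- (w b * y)) else 1.
Proof.
rewrite /VAL => ninv; have := clause_trichotomy x b.
case: ifP => [sat _|_].
  by case: ifP => // /violates_unsat; rewrite sat.
by case: ifP => //= _; rewrite (negPf ninv).
Qed.

Lemma Psi_var_ge0 i xi P : 0 <= Psi_var R C i xi P.
Proof. by rewrite /Psi_var; case: ifP => _; exact: ler0n. Qed.

Lemma joint_weight_ge0 L : 0 <= joint_weight w y L.
Proof.
apply: mulr_ge0; first by apply: prodr_ge0 => i _; exact: Psi_var_ge0.
apply: prodr_ge0 => b _.
by apply: mulr_ge0; [exact: VAL_ge0 | apply: prodr_ge0 => k _; exact: ler0n].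
Qed.

Lemma partition_function_ge0 : 0 <= partition_function C w y.
Proof. by apply: sumr_ge0 => L _; exact: joint_weight_ge0. Qed.

(** * Support of the joint weight *)

Lemma joint_weight_neq0 L : joint_weight w y L != 0 ->
  [/\ forall i, Psi_var R C i (ext_val L i) (ext_par L i) != 0,
      valid C (ext_x L)
    & forall b k, b \in C -> k \in vars b ->
        (b \in ext_par L k) = CON k b (ext_x L)].
Proof.
rewrite mulf_eq0 negb_or => /andP[/prodf_neq0 var0 /prodf_neq0 clause0].
split=> [i||b k bC kb]; first exact: var0.
  apply/forall_inP => b /clause0.
  by rewrite mulf_eq0 negb_or VAL_neq0 => /andP[].
move: (clause0 b bC); rewrite mulf_eq0 negb_or => /andP[_ /prodf_neq0 /(_ k kb)].
by rewrite pnatr_eq0 eqb0 negbK => /eqP.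
Qed.

(** The clause factors only test [b] in [C] against the variables of [b]; any other membership in a
    parent set is excluded by the space over which [L] ranges. *)
Lemma ext_par_sub L i b : b \in ext_par L i -> (b \in C) && (i \in vars b).
Proof.
have /forallP /(_ i) := valP L; rewrite in_setU !powersetE.
by case/orP => /subsetP sub /sub; rewrite in_set => /and3P[-> ->].
Qed.

Lemma CON_vars i b x : CON i b x -> i \in vars b.
Proof. by case/and3P. Qed.

Lemma ext_par_parents L i : joint_weight w y L != 0 ->
  ext_par L i = parents C (ext_x L) i.
Proof.
case/joint_weight_neq0 => _ _ parE; apply/setP => b; rewrite in_set.
apply/idP/andP => [bP|[bC con]].
  by have /andP[bC ib] := ext_par_sub L i b bP; rewrite -parE.
by rewrite parE // (CON_vars i b (ext_x L)).
Qed.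

Lemma lambda_ext_x L : joint_weight w y L != 0 -> L = lambda C (ext_x L).
Proof.
move=> L0; apply/val_inj/ffunP => i.
by rewrite SubK ffunE -ext_par_parents // ffunE -surjective_pairing.
Qed.

Lemma unconstrained_parents x i : unconstrained C x i = (parents C x i == set0).
Proof.
apply/forall_inP/eqP => [unc|par0 b bC].
  apply/setP => b; rewrite in_set in_set0; apply/negP => /andP[/unc ncon].
  exact/negP.
by apply/negP => con; have := in_set0 b; rewrite -par0 in_set bC con.
Qed.

Lemma v_cover_ext_x L : joint_weight w y L != 0 ->
  v_cover C w (\sum_(b in UNSAT C (ext_x L)) w b) (ext_x L).
Proof.
move=> L0; have [var0 xval _] := joint_weight_neq0 L L0.
split=> // i; rewrite unconstrained_parents => /eqP par0.
(* On an empty parent set the variable factor is the indicator of [star]. *)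
move: (var0 i); rewrite ext_par_parents // par0 /Psi_var eqxx ffunE.
by rewrite pnatr_eq0 eqb0 negbK => /eqP ->.
Qed.

(** * Weight of a cover *)

Lemma ext_x_lambda x : ext_x (lambda C x) = x.
Proof. by apply/ffunP => i; rewrite ffunE /ext_val SubK ffunE. Qed.

Lemma ext_par_lambda x i : ext_par (lambda C x) i = parents C x i.
Proof. by rewrite /ext_par SubK ffunE. Qed.

(** Without parents, the cover condition forces [star]. Otherwise every parent has [x i] as its
    satisfying value at [i], so all parents lie on the side of that sign. *)
Lemma Psi_var_cover v x i : v_cover C w v x ->
  Psi_var R C i (x i) (parents C x i) = 1.
Proof.
case=> _ _ /(_ i); rewrite unconstrained_parents /Psi_var.
case: eqVneq => [_ /(_ isT)|/set0Pn[b]]; first by case: (x i) => [[]|] [].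
rewrite in_set => /and3P[_ ib /andP[/eqP xi _]] _.
have parS a : a \in parents C x i ->
    (a \in C) && ((i \in vars a) && (sval_of a i == x i)).
  by rewrite in_set => /and3P[-> -> /andP[/eqP -> _]]; rewrite eqxx.
case Ex: (x i) => [[]|] /=; last first.
- by move: (vars_svalNstar b i ib); rewrite -xi Ex.
- rewrite (_ : parents C x i \subset _) //; apply/subsetP => a aP.
  by rewrite in_set; have := parS a aP; rewrite Ex.
- rewrite (_ : parents C x i \subset _) //; apply/subsetP => a aP.
  by rewrite in_set; have := parS a aP; rewrite Ex.
Qed.

Lemma Psi_clause_lambda b x : b \in C ->
  Psi_clause w y b (lambda C x) = VAL w y b x.
Proof.
move=> bC; rewrite /Psi_clause ext_x_lambda big1 ?mulr1 // => k _.
by rewrite ext_par_lambda in_set bC eqxx.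
Qed.

Lemma joint_weight_cover v x : v_cover C w v x ->
  joint_weight w y (lambda C x) = \prod_(b in UNSAT C x) expR (- (w b * y)).
Proof.
move=> cov; have [/forall_inP xval _ _] := cov.
rewrite /joint_weight big1 => [|i _]; last first.
  by rewrite ext_par_lambda /ext_val SubK ffunE (Psi_var_cover v).
rewrite mul1r (eq_bigr (fun b => if violates x b then expR (- (w b * y)) else 1)).
  (* Clauses that are not violated contribute 1, so the product shrinks to [UNSAT C x]. *)
  by rewrite -big_mkcondr; apply: eq_bigl => b; rewrite in_set.
by move=> b bC; rewrite Psi_clause_lambda // VAL_valid // xval.
Qed.

(** The term of a single cover is a product of exponentials, and all other terms are nonnegative. *)
Lemma partition_function_gt0 v x : v_cover C w v x ->
  0 < partition_function C w y.
Proof.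
move=> cov; apply: (@lt_le_trans _ _ (joint_weight w y (lambda C x))).
  by rewrite (joint_weight_cover v) //; apply: prodr_gt0 => b _; exact: expR_gt0.
rewrite /partition_function (bigD1 (lambda C x)) //= lerDl.
by apply: sumr_ge0 => L _; exact: joint_weight_ge0.
Qed.

End FactorGraph.

Theorem theorem1 (R : realType) (N : nat) (C : {set clause N})
    (w : clause N -> R) (y : R) :
  (forall L : ext_config C, 0 < joint w y L ->
     exists (x : config N) (v : R), v_cover C w v x /\ L = lambda C x)
  /\
  (exists c : R, 0 < c /\
     forall (x : config N) (v : R), v_cover C w v x ->
       config_distr C w y x = c * \prod_(b in UNSAT C x) expR (- (w b * y))).
Proof.
split=> [L L0|].
  have {}L0 : joint_weight w y L != 0.
    by apply: contraTneq L0 => L0; rewrite /joint L0 mul0r ltxx.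
  exists (ext_x L), (\sum_(b in UNSAT C (ext_x L)) w b); split.
    exact: v_cover_ext_x L0.
  exact: lambda_ext_x L0.
(* The partition function vanishes when the instance has no cover at all; any
   positive constant then works. *)
have := partition_function_ge0 C w y; rewrite le_eqVlt => /predU1P[Z0|Z_gt0].
  exists 1; split=> // x v /(partition_function_gt0 C w y v x).
  by rewrite -Z0 ltxx.
exists (partition_function C w y)^-1; split=> [|x v cov].
  by rewrite invr_gt0.
by rewrite /config_distr /joint (joint_weight_cover C w y v x) // mulrC.
Qed.
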